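(* Let $q$ be a power of a prime. Then $N_q(U_3(q))=q-1$, $N_q(U_4(q))=q(q-1)(q+1)$, and for all integers $n\ge 5$ $$N_q(U_n(q)) = q\,N_q(U_{n-1}(q)) + q^{n-2}(q-1).$$ Consequently, for each $n\geq 3$ the number $N_q(U_n(q))$ is given, for all prime powers $q$, by a polynomial in $q$ with integer coefficients depending only on $n$.
   Context: For a prime power $q$, $U_n(q)$ denotes the group of upper triangular $n\times n$ matrices over the finite field $\mathbf{F}_q$ all of whose diagonal entries equal $1$. For a finite group $G$ and a positive integer $k$, $N_k(G)$ denotes the number of irreducible complex characters $\chi$ of $G$ with $\chi(1)=k$. *)

(* Defs.v *)
From HB Require Import structures.
From mathcomp Require Import all_boot all_order all_fingroup all_algebra.
From mathcomp Require Import all_solvable all_field all_character.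

Set Implicit Arguments.
Unset Strict Implicit.
Unset Printing Implicit Defensive.

Import GroupScope GRing.Theory.
Local Open Scope ring_scope.

Definition prime_power (q : nat) : Prop :=
  exists p e : nat, [/\ prime p, (0 < e)%N & q = (p ^ e)%N].

(* [is_trig_mx] is the library's predicate for lower triangular matrices. *)
Definition upper_unitriangular (R : nzRingType) (n : nat) (A : 'M[R]_n) : bool :=
  is_trig_mx A^T && [forall i, A i i == 1].

Lemma upper_unitriangularP (R : nzRingType) (n : nat) (A : 'M[R]_n) :
  reflect ((forall i j : 'I_n, (j < i)%N -> A i j = 0) /\ (forall i, A i i = 1))
          (upper_unitriangular A).
Proof.
apply: (iffP andP) => -[].
  move=> /is_trig_mxP A0 /forallP A1; split=> [i j ltji|i]; last exact/eqP.
  by have := A0 _ _ ltji; rewrite mxE.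
move=> A0 A1; split; last by apply/forallP => i; rewrite A1.
by apply/is_trig_mxP => i j ltij; rewrite mxE A0.
Qed.

Lemma upper_unitriangular1 (R : nzRingType) (n : nat) :
  upper_unitriangular (1%:M : 'M[R]_n).
Proof.
apply/upper_unitriangularP; split=> [i j ltji|i]; rewrite !mxE ?eqxx //.
by rewrite -val_eqE gtn_eqF.
Qed.

Lemma upper_unitriangularM (R : nzRingType) (n : nat) (A B : 'M[R]_n) :
  upper_unitriangular A -> upper_unitriangular B ->
  upper_unitriangular (A *m B).
Proof.
move=> /upper_unitriangularP[A0 A1] /upper_unitriangularP[B0 B1].
apply/upper_unitriangularP; split=> [i j ltji|i]; rewrite mxE.
  rewrite big1 // => k _; case: (ltnP k i) => [/A0->|leik]; first by rewrite mul0r.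
  by rewrite B0 ?mulr0 // (leq_trans ltji).
rewrite (bigD1 i) //= A1 B1 mulr1 big1 ?addr0 // => k.
rewrite -val_eqE neq_ltn => /orP[/A0->|/B0->]; by rewrite ?mul0r ?mulr0.
Qed.

Section UnitriangularGroup.

Variables (n : nat) (F : finFieldType).

(* The elements of {'GL_n[F]} are n.-1.+1 x n.-1.+1 matrices, so this is the
   intended set of n x n matrices as soon as 0 < n. *)
Definition Uset : {set {'GL_n[F]}} :=
  [set u | upper_unitriangular (GLval u)].

Lemma Uset_group_set : group_set Uset.
Proof.
apply/group_setP; split=> [|u v]; rewrite !inE.
  exact: upper_unitriangular1.
exact: upper_unitriangularM.
Qed.

Definition U : {group {'GL_n[F]}} := Group Uset_group_set.

End UnitriangularGroup.

(* The values of characters lie in [algC], the field of algebraic complex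
   numbers; this loses no irreducible complex character of a finite group. *)
Definition N (k : nat) (gT : finGroupType) (G : {group gT}) : nat :=
  #|[set i : Iirr G | 'chi_i 1%g == k%:R]|.

(* Main.v *)
Require Import Defs.
From HB Require Import structures.
From mathcomp Require Import all_boot all_order all_fingroup all_algebra.
From mathcomp Require Import all_solvable all_field all_character.
From mathcomp Require Import zify.

(** Write [G] for U_n(q) with [n = m + 3], [V] for the abelian normal subgroup of
    matrices that differ from the identity in the last column only, and [W] for
    the elements of [V] whose entry in the row above the last one vanishes.

    The characters of [G] trivial on [W] are those of G / W, the direct product of
    V / W (of order q) and a copy of U_(n-1)(q); this gives q N_q(U_(n-1)(q)).

    Let [chi] have degree [q] and be nontrivial on [W]. A constituent of its
    restriction to [V] is a linear character with a nontrivial coordinate in some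
    row [r <= m] (indices start from 0), and the elements of [G] supported on row
    [r] move it along an orbit of size at least q^(m+1-r); hence [r = m] and the
    inertia group is the normal subgroup [T] of index [q] defined by the vanishing
    of entry (m, m+1). So [chi] is induced from a linear character of [T] nontrivial on [W], and every such
    character of [T] induces irreducibly, [q] of them to the same [chi]. They are
    counted through the derived subgroup of [T].

    The resulting recurrence holds for all [n >= 4], with the closed form
    N_q(U_n(q)) = q^(n-3) (q-1) ((n-3) q + 1). *)

Set Implicit Arguments.
Unset Strict Implicit.
Unset Printing Implicit Defensive.

Import GroupScope GRing.Theory Num.Theory.
Local Open Scope ring_scope.

(** * Characters of finite groups *)

Lemma N_isog (gT rT : finGroupType) (G : {group gT}) (H : {group rT}) k :
  G \isog H -> N k G = N k H.
Proof.
case/isogP => f injf defH.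
have isoGH : isom G H f by apply/isomP.
rewrite /N -(card_imset _ (isom_Iirr_inj isoGH)); apply: eq_card => i.
rewrite inE; apply/imsetP/idP => [[j + ->]|chi1].
  by rewrite inE isom_IirrE cfIsom1.
exists (isom_Iirr (isom_sym isoGH) i); last by rewrite isom_IirrKV.
by rewrite inE isom_IirrE cfIsom1.
Qed.

Lemma N_quotient (gT : finGroupType) (G H : {group gT}) k :
  H <| G -> N k (G / H) = #|[set i : Iirr G |
     (H \subset cfker 'chi_i) && ('chi_i 1%g == k%:R)]|.
Proof.
move=> nHG.
rewrite -(on_card_preimset (R := [set i | _ && _]) (f := @mod_Iirr _ G H)).
  apply: eq_card => i; rewrite !inE mod_IirrE // cfker_mod //=.
  by rewrite cfMod1.
exists (quo_Iirr H) => [i _|i]; first exact: mod_IirrK.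
by rewrite inE => /andP[? _]; apply: quo_IirrK.
Qed.

Lemma N_dprod_abelian (gT : finGroupType) (G K H : {group gT}) k :
  K \x H = G -> abelian K -> N k G = (#|K| * N k H)%N.
Proof.
move=> KxH abK; rewrite -(card_Iirr_abelian abK) /N -cardsT -cardsX.
rewrite -(card_imset _ (dprod_Iirr_inj KxH)); apply: eq_card => i.
have lin1 := lin_char1 (char_abelianP _ abK _).
rewrite inE; apply/idP/imsetP => [chi1|[[a b] + ->]]; last first.
  by rewrite !inE dprod_IirrE cfDprod1 /= lin1 mul1r.
exists (inv_dprod_Iirr KxH i); last by rewrite inv_dprod_IirrK.
move: chi1; rewrite -{1}(inv_dprod_IirrK KxH i).
case: (inv_dprod_Iirr _ _) => a b.
by rewrite !inE dprod_IirrE cfDprod1 /= lin1 mul1r.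
Qed.

(** By Clifford's theorem the restriction is a multiple of the sum of the conjugates of ['chi_j],
    which is orthogonal to every irreducible character outside that class. *)
Lemma constt_Res_cfclass (gT : finGroupType) (G H : {group gT})
    (i : Iirr G) (j k : Iirr H) :
    H <| G -> j \in irr_constt ('Res[H] 'chi_i) ->
    k \in irr_constt ('Res[H] 'chi_i) ->
  'chi_k \in ('chi_j ^: G)%CF.
Proof.
move=> nHG cj; rewrite (Clifford_Res_sum_cfclass nHG cj) reindex_cfclass //.
rewrite irr_consttE cfdotZl cfdot_suml; apply: contraR => ncl_k.
rewrite big1 ?mulr0 // => l cl_l; rewrite cfdot_irr.
by case: eqP ncl_k => // <-; rewrite cl_l.
Qed.

(** * Counting characters induced from linear characters of a normal subgroup *)

Section Clifford.

Variables (gT : finGroupType) (G T W : {group gT}).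
Hypotheses (nTG : T <| G) (nWG : W <| G).
Hypothesis inertiaT : forall j : Iirr T,
  'chi_j \is a linear_char -> ~~ (W \subset cfker 'chi_j) ->
  'I_G['chi_j] \subset T.
Hypothesis inducedT : forall i : Iirr G,
  'chi_i 1%g = #|G : T|%:R -> ~~ (W \subset cfker 'chi_i) ->
  exists j : Iirr T, 'chi_i = 'Ind[G] 'chi_j.

Let sTG : T \subset G. Proof. exact: normal_sub. Qed.

Lemma cfker_Ind_normal (j : Iirr T) :
  (W \subset cfker ('Ind[G] 'chi_j)) = (W \subset cfker 'chi_j).
Proof.
rewrite cfker_Ind_irr //; apply/idP/idP => [/subset_trans-> //|sWk].
  exact: gcore_sub.
by rewrite sub_gcore // normal_norm.
Qed.

(** Induction maps the characters counted on the left onto those counted on the right. Its fibres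
    are full [G]-conjugacy classes, of size [#|G : T|] because all inertia groups involved equal
    [T]. *)
Lemma card_lin_chars_induced :
  #|[set j : Iirr T | ('chi_j \is a linear_char) && ~~ (W \subset cfker 'chi_j)]|
  = (#|G : T| * #|[set i : Iirr G |
      ('chi_i 1%g == #|G : T|%:R) && ~~ (W \subset cfker 'chi_i)]|)%N.
Proof.
set Y := [set j | _]; set X := [set i : Iirr G | _].
have q0 : #|G : T|%:R != 0 :> algC by rewrite pnatr_eq0 -lt0n.
have IndY j : j \in Y -> 'Ind[G] 'chi_j \in irr G.
  rewrite inE => /andP[lin_j nWj];
  have defI : 'I_G['chi_j]%G = T.
    apply/val_inj/eqP; rewrite eqEsubset inertiaT //=.
    by rewrite subsetI sTG sub_inertia.
  have [] := constt_Inertia_bijection j nTG; rewrite defI cfInd_id => -> //.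
  by rewrite constt_irr !inE.
pose f (j : Iirr T) := cfIirr ('Ind[G] 'chi_j).
have fE j : j \in Y -> 'chi_(f j) = 'Ind[G] 'chi_j by move/IndY/cfIirrE.
have fX j : j \in Y -> f j \in X.
  move=> Yj; rewrite inE fE // cfker_Ind_normal cfInd1 //.
  by move: Yj; rewrite inE => /andP[lin_j ->]; rewrite lin_char1 ?mulr1 ?eqxx.
(* Induction multiplies the degree by [#|G : T|], so an induced character of degree [#|G : T|] comes
   from a linear one. *)
have fY i j : i \in X -> 'chi_i = 'Ind[G] 'chi_j -> j \in Y.
  rewrite !inE => /andP[chi1 nW] eij; rewrite -cfker_Ind_normal -eij nW andbT.
  move: chi1; rewrite eij cfInd1 // -[X in _ == X]mulr1 (inj_eq (mulfI q0)).
  move/eqP=> chi1.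
  by rewrite qualifE /= irr_char chi1 eqxx.
rewrite -sum1_card (partition_big f (mem X)) //= mulnC -sum_nat_const.
suffices fibers i : i \in X -> (\sum_(j in Y | f j == i) 1)%N = #|G : T|.
  by rewrite (eq_bigr _ fibers).
move=> Xi; rewrite sum1dep_card.
have [j0 eij0] : exists j : Iirr T, 'chi_i = 'Ind[G] 'chi_j.
  by move: (Xi); rewrite inE => /andP[/eqP chi1 nW]; apply: inducedT.
have Yj0 := fY _ _ Xi eij0.
have <- : #|cfclass_Iirr G j0| = #|G : T|.
  rewrite card_cfclass_Iirr //; congr #|_ : _|.
  apply/eqP; rewrite eqEsubset; apply/andP; split.
    by move: Yj0; rewrite inE => /andP[? ?]; apply: inertiaT.
  by rewrite subsetI sTG sub_inertia.
(* Characters inducing the same ['chi_i] are constituents of its restriction by Frobenius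
   reciprocity, hence conjugate; conversely, conjugate characters induce the same character. *)
apply: eq_card => j; rewrite cfclass_IirrE inE.
apply/andP/idP => [[Yj /eqP fji]|cl_j].
  have eij : 'chi_i = 'Ind[G] 'chi_j by rewrite -fE // fji.
  by apply: (constt_Res_cfclass (i := i) nTG);
    rewrite -constt_Ind_Res -?eij -?eij0 constt_irr !inE.
have eij : 'chi_i = 'Ind[G] 'chi_j by rewrite eij0; apply: cfclass_Ind.
have Yj := fY _ _ Xi eij; split=> //.
by apply/eqP/irr_inj; rewrite fE.
Qed.

End Clifford.

(** * Inertia groups of linear characters of an abelian normal subgroup *)

Section AbelianNormal.

Variables (gT : finGroupType) (G T V W : {group gT}).
Hypotheses (nTG : T <| G) (nWG : W <| G) (nVG : V <| G) (abV : abelian V).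
Hypotheses (sVT : V \subset T).
Hypothesis small_inertia : forall l : Iirr V, ~~ (W \subset cfker 'chi_l) ->
  (#|'I_G['chi_l]| <= #|T|)%N.
Hypothesis large_inertia : forall l : Iirr V, ~~ (W \subset cfker 'chi_l) ->
  (#|T| <= #|'I_G['chi_l]|)%N -> T \subset 'I_G['chi_l].

Let sVG : V \subset G. Proof. exact: normal_sub. Qed.
Let sTG : T \subset G. Proof. exact: normal_sub. Qed.

(** If ['chi_l] is the restriction of ['chi_j] to [V], then [T] lies in the inertia group of
    ['chi_j], which lies in that of ['chi_l]; the order bound collapses this chain. *)
Lemma inertia_lin_char (j : Iirr T) :
    'chi_j \is a linear_char -> ~~ (W \subset cfker 'chi_j) ->
  'I_G['chi_j] \subset T.
Proof.
move=> lin_j nWj; have lin_l : 'Res[V] 'chi_j \is a linear_char.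
  exact: cfRes_lin_char.
have /irrP[l el] := lin_char_irr lin_l.
have nWl : ~~ (W \subset cfker 'chi_l).
  rewrite -el; apply: contra nWj => /subsetP sWl; apply/subsetP => x Wx.
  have := sWl x Wx; rewrite !cfkerEchar ?lin_charW // !inE.
  by case/andP=> Vx; rewrite !cfResE ?group1 // (subsetP sVT).
have sTI : T \subset 'I_G['chi_j] by rewrite subsetI sTG sub_inertia.
have sII : 'I_G['chi_j] \subset 'I_G['chi_l].
  by rewrite -el sub_inertia_Res // normal_norm.
have: T :==: 'I_G['chi_l].
  by rewrite eqEcard (subset_trans sTI sII) small_inertia.
by rewrite eqEsubset => /andP[_]; apply: subset_trans sII.
Qed.

(** By the Clifford correspondence, ['chi_i] is induced from the inertia group of a constituent of
    its restriction to [V]. Its degree bounds the index of that group by [#|G : T|], and the two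
    inertia hypotheses identify the group with [T]. Linearity of ['chi_j] then follows from the
    degree. *)
Lemma induced_from_lin_char (i : Iirr G) :
    'chi_i 1%g = #|G : T|%:R -> ~~ (W \subset cfker 'chi_i) ->
  exists j : Iirr T, 'chi_i = 'Ind[G] 'chi_j.
Proof.
move=> chi1 nWi; have [l cl] := constt_cfRes_irr V i.
have ci : i \in irr_constt ('Ind[G] 'chi_l) by rewrite constt_Ind_Res.
have nWl : ~~ (W \subset cfker 'chi_l).
  apply: contra nWi => sWl.
  apply: subset_trans (cfker_constt (cfInd_char _ (irr_char l)) ci).
  by rewrite cfker_Ind_irr // sub_gcore // normal_norm.
have [irrI _ /(_ i) + _ _] := constt_Inertia_bijection l nVG.
rewrite ci => /imsetP[s cs eis].
have ei : 'chi_i = 'Ind[G] 'chi_s by rewrite eis cfIirrE ?irrI.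
have sIG : 'I_G['chi_l] \subset G by apply: subsetIl.
have defI : 'I_G['chi_l]%G = T.
  suffices leT : (#|T| <= #|'I_G['chi_l]|)%N.
    apply/val_inj/eqP; rewrite eq_sym eqEcard large_inertia //=.
    exact: small_inertia.
  have: (#|G : 'I_G['chi_l]| <= #|G : T|)%N.
    move: chi1; rewrite ei cfInd1 //.
    have := irr1_gt0 s; rewrite irr1_degree ltr0n -natrM => d_gt0 /eqP.
    by rewrite eqr_nat => /eqP <-; rewrite leq_pmulr.
  rewrite -(leq_pmul2l (cardG_gt0 T)) Lagrange // -(Lagrange sIG).
  by rewrite leq_pmul2r.
by move: s cs eis ei; rewrite defI => s _ _ ei; exists s.
Qed.

End AbelianNormal.

Lemma card_Iirr_ker_der (gT : finGroupType) (G M : {group gT}) :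
  M <| G -> G^`(1)%g \subset M ->
  #|[set i : Iirr G | M \subset cfker 'chi_i]| = #|G : M|.
Proof.
move=> nMG sG'M; rewrite -card_quotient ?normal_norm //.
rewrite -card_Iirr_abelian ?sub_der1_abelian // -cardsT.
rewrite -(on_card_preimset (R := [set i | M \subset cfker 'chi_i])
  (f := @mod_Iirr _ G M)).
  by apply: eq_card => i; rewrite !inE mod_IirrE // cfker_mod.
exists (quo_Iirr M) => [i _|i]; first exact: mod_IirrK.
by rewrite inE; apply: quo_IirrK.
Qed.

(** Linear characters are those trivial on the derived subgroup; the ones also trivial on [W] are
    those trivial on the join, and are subtracted. *)
Lemma card_lin_chars_nontrivial (gT : finGroupType) (G W : {group gT}) :
  W <| G ->
  #|[set i : Iirr G | ('chi_i \is a linear_char) && ~~ (W \subset cfker 'chi_i)]|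
  = (#|G : G^`(1)%g| - #|G : G^`(1)%g <*> W|)%N.
Proof.
move=> nWG; have nG'G := der_normal 1 G.
have nMG : G^`(1) <*> W <| G by apply: normalY.
rewrite -(card_Iirr_ker_der nG'G) // -(card_Iirr_ker_der nMG) ?joing_subl //.
rewrite -(@cardsID _ [set i | W \subset cfker 'chi[G]_i]
                     [set i | G^`(1)%g \subset cfker 'chi[G]_i]).
pose kerDW := [set i | G^`(1) <*> W \subset cfker 'chi[G]_i].
rewrite [X in (_ = X + _ - _)%N](_ : _ = #|kerDW|) ?addKn.
  by apply: eq_card => i; rewrite !inE lin_irr_der1 andbC.
by apply: eq_card => i; rewrite !inE join_subG.
Qed.

(** This rests on [l (v ^ y) = l v * l [~ v, y]], where [l v] is nonzero. *)
Lemma inertia_linP (gT : finGroupType) (V : {group gT}) (l : 'CF(V)) y :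
  l \is a linear_char -> y \in 'N(V) ->
  reflect (forall v, v \in V -> [~ v, y] \in cfker l) (y \in 'I[l]).
Proof.
move=> lin_l nVy; have kerE x : x \in V -> (x \in cfker l) = (l x == 1).
  by move=> Vx; rewrite cfkerEchar ?lin_charW // inE Vx lin_char1.
have commV v : v \in V -> [~ v, y] \in V.
  by move=> Vv; rewrite commgEl groupM ?groupV ?memJ_norm.
have lJ v : v \in V -> l (v ^ y)%g = l v * l [~ v, y].
  by move=> Vv; rewrite conjg_mulR lin_charM ?commV.
apply: (iffP idP) => [Iy v Vv|kerl].
  have lv0 := lin_char_neq0 lin_l Vv.
  rewrite kerE ?commV // -(inj_eq (mulfI lv0)) mulr1 -lJ //.
  by rewrite inertia_valJ.
(* The conjugate of [l] by [y^-1] is evaluated at [v ^ y], so invariance is tested for [y^-1]. *)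
rewrite -groupV inE groupV nVy; apply/eqP/cfun_inP => v Vv.
rewrite cfConjgE ?groupV // invgK lJ //.
by have := kerl v Vv; rewrite kerE ?commV // => /eqP->; rewrite mulr1.
Qed.

(** * Pattern groups *)

Section PatternGroups.

Variables (m : nat) (F : finFieldType).
Implicit Types (A B C D H : rel 'I_m.+1) (u v : {'GL_m.+1[F]}).
Implicit Types (i j k : 'I_m.+1).

Definition ord_lt : rel 'I_m.+1 := fun i j => (i < j)%N.

(** These are the closed sets of positive roots of type A; transitivity makes [pat D] closed under
    products. *)
Definition pattern D := subrel D ord_lt /\ transitive D.

(** It bounds the support of [X *m Y] when [X] is supported on [A] and [Y] on [B]. *)
Definition rel_comp A B : rel 'I_m.+1 :=
  fun i k => [exists j, A i j && B j k].

Lemma rel_compP A B i k :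
  reflect (exists j, A i j /\ B j k) (rel_comp A B i k).
Proof.
by apply: (iffP existsP) => -[j]; [move/andP | case=> ? ?]; exists j => //;
  apply/andP.
Qed.

(** The type ascription replaces the convertible size [m.+1.-1.+1] of [GLval u] by [m.+1]. *)
Definition ent u : 'M[F]_m.+1 := GLval u.

Lemma ent_inj : injective ent. Proof. exact: val_inj. Qed.

Lemma entM u v : ent (u * v)%g = ent u *m ent v. Proof. by []. Qed.

Lemma ent1 : ent 1%g = 1%:M. Proof. by []. Qed.

Definition pat D : {set {'GL_m.+1[F]}} :=
  [set u | [forall i, forall j,
              ~~ D i j ==> (ent u i j == (i == j)%:R)]].

Lemma patP D u :
  reflect (forall i j, ~~ D i j -> ent u i j = (i == j)%:R) (u \in pat D).
Proof.
rewrite inE; apply: (iffP forallP) => [uD i j nDij|uD i].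
  by have /forallP/(_ j)/implyP/(_ nDij)/eqP := uD i.
by apply/forallP => j; apply/implyP => nDij; rewrite uD.
Qed.

Lemma pat_sub A B : subrel A B -> pat A \subset pat B.
Proof.
move=> sAB; apply/subsetP => u /patP uA; apply/patP => i j nB.
by apply: uA; apply: contra nB; apply: sAB.
Qed.

Lemma pat_diag D u i : subrel D ord_lt -> u \in pat D -> ent u i i = 1.
Proof.
move=> ltD /patP->; first by rewrite eqxx.
by apply/negP => /ltD; rewrite /ord_lt ltnn.
Qed.

Lemma pat_neq0 D u i j :
  u \in pat D -> ent u i j - (i == j)%:R != 0 -> D i j.
Proof. by move/patP => uD; apply: contraNT => /uD->; rewrite subrr. Qed.

Lemma pat_group_set D : pattern D -> group_set (pat D).
Proof.
case=> ltD trD; apply/group_setP; split=> [|u v uD vD].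
  by apply/patP => i j _; rewrite ent1 mxE.
apply/patP => i j nDij; rewrite entM mxE.
have /patP u0 := uD; have /patP v0 := vD.
rewrite (bigD1 i) //= (pat_diag _ ltD uD) mul1r big1 ?addr0 ?v0 // => k ki.
case Dik: (D i k); last by rewrite u0 ?Dik // eq_sym (negPf ki) mul0r.
case Dkj: (D k j); first by rewrite (trD _ _ _ Dik Dkj) in nDij.
rewrite v0 ?Dkj //; case: eqP => [kj|_]; last by rewrite mulr0.
by rewrite -kj Dik in nDij.
Qed.

Definition pat_group D (pD : pattern D) := Group (pat_group_set pD).

Lemma unitri_unit (M : 'M[F]_m.+1) :
  upper_unitriangular M -> M \is a GRing.unit.
Proof.
case/andP=> tM /forallP M1; rewrite -[_ \is a _]/(M \in unitmx) unitmxE.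
by rewrite -det_tr det_trig // big1 ?unitr1 // => i _; rewrite mxE; apply/eqP.
Qed.

Definition mkGL (M : 'M[F]_m.+1) : {'GL_m.+1[F]} :=
  insubd (1%g : {'GL_m.+1[F]}) M.

Lemma mkGLE M : upper_unitriangular M -> ent (mkGL M) = M.
Proof. by move=> /unitri_unit uM; rewrite /mkGL /insubd insubT. Qed.

Lemma ord_lt_pattern : pattern ord_lt.
Proof. by split=> // i j k; apply: ltn_trans. Qed.

Lemma pat_ord_lt : pat ord_lt = U m.+1 F.
Proof.
apply/setP=> u; apply/idP/idP.
  move=> uL; rewrite inE; apply/upper_unitriangularP; split=> [i j ltji|i].
    have /patP-> := uL; last by rewrite -leqNgt ltnW.
    by rewrite -val_eqE gtn_eqF.
  exact: pat_diag uL.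
rewrite inE => /upper_unitriangularP[u0 u1]; apply/patP => i j.
rewrite -leqNgt leq_eqVlt => /predU1P[|ltji].
  by move/val_inj->; rewrite u1 eqxx.
by rewrite u0 // -val_eqE gtn_eqF.
Qed.

Definition root_elt i j (c : F) := mkGL (1%:M + c *: delta_mx i j).

Lemma root_eltE i j c :
  (i < j)%N -> ent (root_elt i j c) = 1%:M + c *: delta_mx i j.
Proof.
move=> ltij; apply/mkGLE/upper_unitriangularP; split=> [k l ltlk|k]; rewrite !mxE.
  rewrite -val_eqE (gtn_eqF ltlk) add0r.
  case: (k =P i) ltlk => [->|_]; case: (l =P j) => [->|]; rewrite ?mulr0 //.
  by rewrite ltnNge ltnW.
rewrite eqxx; case: (k =P i) => [->|_]; last by rewrite mulr0 addr0.
by case: (i =P j) ltij => [->|_]; rewrite ?ltnn // mulr0 addr0.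
Qed.

Lemma root_elt_pat D i j c : (i < j)%N -> D i j -> root_elt i j c \in pat D.
Proof.
move=> ltij Dij; apply/patP => k l nD; rewrite root_eltE // !mxE.
case: (k =P i) nD => [->|_]; last by rewrite mulr0 addr0.
by case: (l =P j) => [->|_]; rewrite ?Dij // mulr0 addr0.
Qed.

(* Entries are cleared from the bottom row upwards: when all rows below row [r]
   are those of the identity, left multiplication by a root element at [(r, j)]
   changes the single entry [(r, j)]. *)
Lemma pat_gen D (L : {group {'GL_m.+1[F]}}) :
    subrel D ord_lt -> (forall i j c, D i j -> root_elt i j c \in L) ->
  pat D \subset L.
Proof.
move=> ltD rL; apply/subsetP => u.
pose nz (u : {'GL_m.+1[F]}) : {set 'I_m.+1 * 'I_m.+1} :=
  [set p | ent u p.1 p.2 - (p.1 == p.2)%:R != 0].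
have [s] := ubnP #|nz u|; elim: s u => // s IHs u ltus uD.
have [u1|/set0Pn[p0 p0u]] := eqVneq (nz u) set0.
  suffices -> : u = 1%g by [].
  apply/ent_inj/matrixP => i j /=; rewrite mxE; apply/eqP.
  by rewrite -subr_eq0; apply: contraTT isT => nz_ij; have := in_set0 (i, j);
     rewrite -u1 inE nz_ij.
case: (@arg_maxnP _ p0 (mem (nz u)) (fun p => nat_of_ord p.1) p0u).
move=> -[r j] /= nz_rj max_r.
have := nz_rj; rewrite inE /= => nz1.
have Drj := pat_neq0 uD nz1; have ltrj : (r < j)%N := ltD _ _ Drj.
set a := ent u r j.
(* Since [r < j], row [j] is trivial by the maximality of [r]. *)
have rowj l : ent u j l = (j == l)%:R.
  apply/eqP; rewrite -subr_eq0; apply: contraTT ltrj => nz_jl; rewrite -leqNgt.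
  by have := max_r (j, l); rewrite !inE /=; apply.
pose v := (root_elt r j (- a) * u)%g.
have vE i l : ent v i l = if (i == r) && (l == j) then 0 else ent u i l.
  rewrite entM root_eltE // mulmxDl mul1mx -scalemxAl !mxE.
  rewrite (bigD1 j) //= mxE eqxx andbT big1 ?addr0 => [|k kj].
    rewrite rowj; case: eqP => [->|] /=; last by rewrite mul0r mulr0 addr0.
    rewrite eq_sym mul1r; case: eqP => [->|]; last by rewrite mulr0 addr0.
    by rewrite mulr1 subrr.
  by rewrite mxE (negPf kj) andbF mul0r.
suffices vL : v \in L.
  by rewrite -(groupMl _ (rL _ _ (- a) Drj)).
have rj0: (r == j) = false by rewrite -val_eqE ltn_eqF.
apply: IHs; last first.
  apply/patP => i l nD; rewrite vE; have /patP-> := uD => //.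
  by case: andP nD => // -[/eqP-> /eqP->]; rewrite Drj.
rewrite -ltnS; apply: leq_trans ltus; rewrite ltnS; apply: proper_card.
apply/properP; split; last first.
  exists (r, j) => //; by rewrite inE /= vE !eqxx rj0 subr0 eqxx.
apply/subsetP => -[i l]; rewrite !inE /= vE.
by case: andP => // -[/eqP-> /eqP->]; rewrite rj0 subr0 eqxx.
Qed.

Lemma card_pat D :
  subrel D ord_lt -> #|pat D| = (#|F| ^ #|[set p | D p.1 p.2]|)%N.
Proof.
move=> ltD; rewrite -[RHS](card_pffun_on 0); set S := pffun_on _ _ _.
pose f (g : {ffun 'I_m.+1 * 'I_m.+1 -> F}) : {'GL_m.+1[F]} :=
  mkGL (\matrix_(i, j) ((i == j)%:R + g (i, j))).
have fE g : g \in S -> ent (f g) = \matrix_(i, j) ((i == j)%:R + g (i, j)).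
  case/pffun_onP=> /supportP supp _; apply/mkGLE/upper_unitriangularP.
  split=> [i j ltji|i]; rewrite mxE supp ?addr0 ?eqxx //.
  - by rewrite -val_eqE gtn_eqF.
  - by rewrite inE; apply/negP=> /ltD; rewrite /ord_lt /= ltnNge ltnW.
  - by rewrite inE; apply/negP=> /ltD; rewrite /ord_lt /= ltnn.
rewrite -(@card_in_imset _ _ f) => [|g h gS hS eq_gh].
  apply: eq_card => u; apply/idP/imsetP => [/patP uD|[g gS ->]].
    have gS: [ffun p => ent u p.1 p.2 - (p.1 == p.2)%:R] \in S.
      apply/pffun_onP; split=> //; apply/supportP => p; rewrite inE ffunE.
      by move/uD->; rewrite subrr.
    exists [ffun p => ent u p.1 p.2 - (p.1 == p.2)%:R] => //.
    by apply/ent_inj/matrixP => i j /=; rewrite fE // mxE ffunE addrC subrK.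
  apply/patP => i j nD; rewrite fE // mxE; case/pffun_onP: gS => /supportP-> //.
    by rewrite addr0.
  by rewrite inE.
apply/ffunP => -[i j]; move/(congr1 ent)/matrixP/(_ i j): eq_gh.
by rewrite !fE // !mxE => /addrI.
Qed.

(* With [x = 1 + X] and [y = 1 + Y], [[~ x, y] - 1 = (y x)^-1 (X Y - Y X)]. *)
Lemma pat_comm A B C H x y :
    pattern H -> subrel A H -> subrel B H -> subrel (rel_comp A B) C ->
    subrel (rel_comp B A) C -> subrel (rel_comp H C) C ->
  x \in pat A -> y \in pat B -> [~ x, y] \in pat C.
Proof.
move=> pH sAH sBH sAB sBA sHC xA yB.
have [ltH trH] := pH.
have xH : x \in pat_group pH := subsetP (pat_sub sAH) x xA.
have yH : y \in pat_group pH := subsetP (pat_sub sBH) y yB.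
have wH : (y * x)^-1%g \in pat H.
  by rewrite (@groupVl _ (pat_group pH)) ?invgK ?groupM.
set w := (_^-1)%g in wH.
pose X := ent x - 1%:M; pose Y := ent y - 1%:M.
have eZ : ent [~ x, y] = 1%:M + ent w *m (X *m Y - Y *m X).
  have -> : X *m Y - Y *m X = ent (x * y)%g - ent (y * x)%g.
    have mul1B (M N : 'M[F]_m.+1) :
        (M - 1%:M) *m (N - 1%:M) = M *m N + (1%:M - (M + N)).
      rewrite mulmxBl !mulmxBr !mulmx1 mul1mx opprB -!addrA; congr (_ + _).
      by rewrite opprD addrCA addrA addrC.
    rewrite !mul1B [ent y + _]addrC; set Q := 1%:M - _.
    by rewrite opprD addrACA subrr addr0 !entM.
  rewrite mulmxBr -!entM mulVg ent1 addrC subrK; congr ent.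
  by rewrite /w invMg /commg conjgE -!mulgA.
have XY0 j k : ~~ C j k -> (X *m Y - Y *m X) j k = 0.
  move=> nC; rewrite !mxE !big1 ?subrr // => l _; apply/eqP; rewrite mulf_eq0.
    apply: contraR nC; rewrite negb_or => /andP[Yjl Xlk]; apply: sBA.
    by apply/rel_compP; exists l; rewrite !mxE in Yjl Xlk; split;
      [apply: pat_neq0 Yjl | apply: pat_neq0 Xlk].
  apply: contraR nC; rewrite negb_or => /andP[Xjl Ylk]; apply: sAB.
  by apply/rel_compP; exists l; rewrite !mxE in Xjl Ylk; split;
    [apply: pat_neq0 Xjl | apply: pat_neq0 Ylk].
(* A nonzero summand of the correction term at [(i, k)] has [C j k] and either [i = j] or [H i j];
   both give [C i k]. *)
apply/patP => i k nC; rewrite eZ [LHS]mxE [X in X + _]mxE [X in _ + X]mxE.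
rewrite big1 ?addr0 // => j _.
have [Cjk|/XY0->] := boolP (C j k); last by rewrite mulr0.
have [eij|nij] := eqVneq i j; first by rewrite eij Cjk in nC.
have /patP-> := wH; first by rewrite (negPf nij) mul0r.
by apply: contra nC => Hij; apply: sHC; apply/rel_compP; exists j.
Qed.

End PatternGroups.

(** * Derived subgroups, normality and indices of pattern groups *)

Section PatternCommutators.

Variables (m : nat) (F : finFieldType).
Implicit Types (A B C D H : rel 'I_m.+1) (u v : {'GL_m.+1[F]}).
Implicit Types (i j k : 'I_m.+1).

Lemma rel_comp_pattern D : pattern D -> pattern (rel_comp D D).
Proof.
case=> ltD trD; split=> [i k /rel_compP[j [Dij Djk]]|j i k].
  exact: ltD (trD _ _ _ Dij Djk).
move=> /rel_compP[a [Dia Daj]] /rel_compP[b [Djb Dbk]].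
by apply/rel_compP; exists j; split; [apply: trD Daj | apply: trD Dbk].
Qed.

Lemma root_elt_comm i j k a b : (i < j)%N -> (j < k)%N ->
  [~ root_elt i j a, root_elt j k b] = root_elt i k (a * b) :> {'GL_m.+1[F]}.
Proof.
move=> ltij ltjk; have ltik := ltn_trans ltij ltjk.
set x := root_elt i j a; set y := root_elt j k b.
(* Multiplying by [y * x] removes the inverses from the commutator. *)
apply: (mulgI (y * x)%g); transitivity (x * y)%g.
  by rewrite commgEl conjgE -!mulgA mulKVg mulKVg.
apply: ent_inj; rewrite !entM !root_eltE //.
rewrite !(mulmxDl, mulmxDr, mul1mx, mulmx1) -!scalemxAl -!scalemxAr.
rewrite !mul_delta_mx_cond !eqxx.
have eji : (j == i) = false by rewrite -val_eqE gtn_eqF.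
have eki : (k == i) = false by rewrite -val_eqE gtn_eqF.
rewrite eji eki /= !mulr0n !scaler0 mul0mx !scaler0 !addr0 mulr1n scalerA.
by rewrite -!addrA; congr (_ + _); rewrite addrCA.
Qed.

(** Each root element at a position of [rel_comp D D] is a commutator of root elements of [D], and
    these generate; the other inclusion is [pat_comm]. *)
Lemma der_pat D (pD : pattern D) :
  ((pat_group F pD)^`(1))%g = pat F (rel_comp D D).
Proof.
have [ltD trD] := pD; have pD2 := rel_comp_pattern pD.
apply/eqP; rewrite eqEsubset; apply/andP; split; last first.
  apply: pat_gen; first by case: pD2.
  move=> i k c /rel_compP[j [Dij Djk]].
  rewrite -[c]mulr1 -(@root_elt_comm i j k) ?(ltD _ _ _) //; try exact: ltD.
  by apply: mem_commg; apply: root_elt_pat => //; apply: ltD.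
rewrite derg1 -[pat _ _]/(gval (pat_group F pD2)) gen_subG.
apply/subsetP => _ /imset2P[x y Dx Dy ->].
apply: (pat_comm (A := D) (B := D) (H := D)) => // i k.
move=> /rel_compP[j [Dij /rel_compP[l [Djl Dlk]]]].
by apply/rel_compP; exists j; split=> //; apply: trD Dlk.
Qed.

Lemma pat_abelian D (pD : pattern D) :
  (forall i k, ~~ rel_comp D D i k) -> abelian (pat_group F pD).
Proof.
move=> D2; apply/derG1P/trivgP; have := der_pat pD => /= ->.
apply/subsetP=> x /patP x1.
by rewrite inE; apply/eqP/ent_inj/matrixP => i j; rewrite x1 // ent1 mxE.
Qed.

Lemma pat_commg_sub A B C H (pA : pattern A) (pB : pattern B) (pC : pattern C) :
    pattern H -> subrel A H -> subrel B H -> subrel (rel_comp A B) C ->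
    subrel (rel_comp B A) C -> subrel (rel_comp H C) C ->
  [~: pat_group F pA, pat_group F pB] \subset pat_group F pC.
Proof.
move=> pH sAH sBH sAB sBA sHC; rewrite gen_subG.
by apply/subsetP => _ /imset2P[x y Ax By ->]; apply: (pat_comm pH) Ax By.
Qed.

Lemma pat_normal A H (pA : pattern A) (pH : pattern H) :
    subrel A H -> subrel (rel_comp A H) A -> subrel (rel_comp H A) A ->
  pat_group F pA <| pat_group F pH.
Proof.
move=> sAH sR sL; rewrite /normal pat_sub //.
rewrite -(commg_subl (pat_group F pA) (pat_group F pH)).
exact: (pat_commg_sub pA pH pA pH).
Qed.

Lemma card_pat_add1 A B (a b : 'I_m.+1) :
    subrel B (@ord_lt m) -> ~~ A a b ->
    (forall i j, B i j = A i j || (i == a) && (j == b)) ->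
  #|pat F B| = (#|F| * #|pat F A|)%N.
Proof.
move=> ltB nAab defB.
have ltA : subrel A (@ord_lt m) by move=> i j Aij; apply: ltB; rewrite defB Aij.
rewrite !card_pat // -expnS; congr (_ ^ _)%N.
rewrite (cardsD1 (a, b)) inE /= defB !eqxx orbT add1n; congr _.+1.
apply: eq_card => -[i j]; rewrite !inE /= defB xpair_eqE.
have [/andP[/eqP-> /eqP->]|_] := boolP ((i == a) && (j == b)).
  by rewrite (negPf nAab).
by rewrite orbF.
Qed.

End PatternCommutators.

(** * Subgroups of the unitriangular group *)

Lemma finField_card_gt1 (F : finFieldType) : (1 < #|F|)%N.
Proof.
by rewrite -cardsT (cardsD1 0) (cardsD1 1) !inE oner_neq0.
Qed.

Section UnitriangularSubgroups.

Variables (m : nat) (F : finFieldType).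
Implicit Types (i j k : 'I_m.+3).

(* [patT], [patV], [patW] describe the groups T, V, W above; [patW0] is the part
   of [patW] above row m, [patG1] a complement of V modulo W, and [patR r] is
   supported on row r to the left of the last column. *)
Definition patT : rel 'I_m.+3 :=
  fun i j => (i < j)%N && ~~ ((i == m :> nat) && (j == m.+1 :> nat)).
Definition patV : rel 'I_m.+3 := fun i j => (i < j)%N && (j == m.+2 :> nat).
Definition patW : rel 'I_m.+3 := fun i j => (i <= m)%N && (j == m.+2 :> nat).
Definition patW0 : rel 'I_m.+3 := fun i j => (i < m)%N && (j == m.+2 :> nat).
Definition patG1 : rel 'I_m.+3 :=
  fun i j => (i < j)%N && ~~ ((i == m.+1 :> nat) && (j == m.+2 :> nat)).
Definition patR (r : 'I_m.+3) : rel 'I_m.+3 :=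
  fun i j => [&& i == r, i < j & j < m.+2]%N.

Lemma patT_pattern : pattern patT.
Proof. by split=> [i j|j i k]; rewrite /patT /ord_lt; lia. Qed.
Lemma patV_pattern : pattern patV.
Proof. by split=> [i j|j i k]; rewrite /patV /ord_lt; lia. Qed.
Lemma patW_pattern : pattern patW.
Proof. by split=> [i j|j i k]; rewrite /patW /ord_lt; lia. Qed.
Lemma patW0_pattern : pattern patW0.
Proof. by split=> [i j|j i k]; rewrite /patW0 /ord_lt; lia. Qed.
Lemma patG1_pattern : pattern patG1.
Proof. by split=> [i j|j i k]; rewrite /patG1 /ord_lt; lia. Qed.
Lemma patR_pattern r : pattern (patR r).
Proof.
split=> [i j /and3P[]//|j i k]; rewrite /patR -!val_eqE /=; lia.
Qed.

Local Notation G := (pat_group F (ord_lt_pattern m.+2)).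
Local Notation T := (pat_group F patT_pattern).
Local Notation V := (pat_group F patV_pattern).
Local Notation W := (pat_group F patW_pattern).
Local Notation W0 := (pat_group F patW0_pattern).
Local Notation G1 := (pat_group F patG1_pattern).
Local Notation R := (fun r => pat_group F (patR_pattern r)).
Local Notation q := #|F|.

Lemma normal_T : T <| G.
Proof.
apply: pat_normal => [i j|i k /rel_compP[j]|i k /rel_compP[j]];
  rewrite /patT /ord_lt; lia.
Qed.

Lemma normal_V : V <| G.
Proof.
apply: pat_normal => [i j|i k /rel_compP[j]|i k /rel_compP[j]];
  rewrite /patV /ord_lt; try have := ltn_ord k; lia.
Qed.

Lemma normal_W : W <| G.
Proof.
apply: pat_normal => [i j|i k /rel_compP[j]|i k /rel_compP[j]];
  rewrite /patW /ord_lt; try have := ltn_ord k; lia.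
Qed.

Lemma sub_WV : W \subset V.
Proof. by apply: pat_sub => i j; rewrite /patW /patV; lia. Qed.

Lemma sub_VT : V \subset T.
Proof. by apply: pat_sub => i j; rewrite /patT /patV; lia. Qed.

Lemma sub_WG1 : W \subset G1.
Proof. by apply: pat_sub => i j; rewrite /patW /patG1; lia. Qed.

(** This makes [V / W] central in [G / W], as the direct product decomposition requires. *)
Lemma commg_VG : [~: V, G] \subset W.
Proof.
apply: (pat_commg_sub _ _ _ _ (ord_lt_pattern _)) => // [i j|i k|i k|i k];
  rewrite ?/(rel_comp _ _ _ _); try move=> /rel_compP[j];
  rewrite /patV /patW /ord_lt; try have := ltn_ord k; lia.
Qed.

(** A product reaching [(m, m+2)] would pass through [(m, m+1)], which [patT] omits. *)
Lemma commg_VT : [~: V, T] \subset W0.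
Proof.
apply: (pat_commg_sub _ _ _ _ (ord_lt_pattern _)) => // [i j|i j|i k|i k|i k];
  try move=> /rel_compP[j];
  rewrite /patV /patT /patW0 /ord_lt; try try have := ltn_ord k; lia.
Qed.

Lemma abelian_V : abelian V.
Proof.
apply: pat_abelian => i k; apply/rel_compP => -[j].
by rewrite /patV; have := ltn_ord k; lia.
Qed.

Lemma card_G_T : #|G| = (q * #|T|)%N.
Proof.
apply: (@card_pat_add1 _ _ _ _ (inord m) (inord m.+1)) => //.
  by rewrite /patT !inordK; lia.
by move=> i j; rewrite /patT /ord_lt -!val_eqE /= !inordK; lia.
Qed.

Lemma card_V_W : #|V| = (q * #|W|)%N.
Proof.
apply: (@card_pat_add1 _ _ _ _ (inord m.+1) (inord m.+2)) => //.
- by case: patV_pattern.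
- by rewrite /patW !inordK; lia.
by move=> i j; rewrite /patV /patW -!val_eqE /= !inordK; lia.
Qed.

Lemma card_G_G1 : #|G| = (q * #|G1|)%N.
Proof.
apply: (@card_pat_add1 _ _ _ _ (inord m.+1) (inord m.+2)) => //.
  by rewrite /patG1 !inordK; lia.
by move=> i j; rewrite /patG1 /ord_lt -!val_eqE /= !inordK; lia.
Qed.

(** The two excluded positions can be reached only through [(m, m+1)]; any other is reached through
    the intermediate index [i+1]. *)
Lemma comp_patTE i k : rel_comp patT patT i k =
  [&& i.+1 < k, ~~ ((i == m :> nat) && (k == m.+2 :> nat))
    & ~~ ((i.+1 == m :> nat) && (k == m.+1 :> nat))]%N.
Proof.
apply/rel_compP/idP => [[j]|ik]; first by rewrite /patT; lia.
exists (inord i.+1); rewrite /patT !inordK; have := ltn_ord k; lia.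
Qed.

(** Only [(m, m+2)] has to be added: the other positions of [patW] already lie in
    [rel_comp patT patT]. *)
Let patTW : rel 'I_m.+3 :=
  fun i k => rel_comp patT patT i k || (i == m :> nat) && (k == m.+2 :> nat).

Let patTW_pattern : pattern patTW.
Proof. by split=> [i j|j i k]; rewrite /patTW !comp_patTE /ord_lt; lia. Qed.

Lemma der_T_W : T^`(1)%g <*> W = pat F patTW.
Proof.
apply/eqP; rewrite eqEsubset; apply/andP; split.
  rewrite -[pat F patTW]/(gval (pat_group F patTW_pattern)) join_subG der_pat.
  apply/andP; split; apply: pat_sub => i j; rewrite /patTW ?comp_patTE /patW; lia.
apply: (@pat_gen _ _ _ (T^`(1) <*> W)%G) => [|i j c].
  by case: patTW_pattern.
rewrite /patTW => /orP[cT|mj]; rewrite mem_gen // in_setU;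
  apply/orP; [left|right].
  rewrite der_pat; apply: root_elt_pat => //.
  by move: cT; rewrite comp_patTE; lia.
apply: root_elt_pat; rewrite ?/patW; lia.
Qed.

Lemma card_der_T_W : #|T^`(1)%g <*> W| = (q * #|T^`(1)%g|)%N.
Proof.
rewrite der_T_W der_pat.
apply: (@card_pat_add1 _ _ _ _ (inord m) (inord m.+2)) => //.
- by case: patTW_pattern.
- by rewrite comp_patTE !inordK; lia.
by move=> i j; rewrite /patTW comp_patTE -!val_eqE /= !inordK; lia.
Qed.

(** The exponent counts the positions of [patT] lost in the derived subgroup: the [m+1] positions
    [(i, i+1)] with [i] other than [m], then [(m, m+2)], and [(m-1, m+1)]. For [m = 0] the last does
    not exist, whence the case distinction. *)
Lemma card_T_der : #|T| = (q ^ (if (0 < m)%N then m.+3 else 2) * #|T^`(1)%g|)%N.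
Proof.
have [ltT _] := patT_pattern; have [ltC _] := rel_comp_pattern patT_pattern.
rewrite der_pat !card_pat // -expnD; congr (_ ^ _)%N.
rewrite -(cardsID [set p | rel_comp patT patT p.1 p.2]) addnC.
congr (_ + _)%N; last first.
  by apply: eq_card => -[i k]; rewrite !inE /= comp_patTE /patT; lia.
(* [f] lists, column by column except for [k = 0], the pairs of [patT] that are
   not in [rel_comp patT patT]; [k = m + 1] gives no pair when [m = 0]. *)
pose f (k : 'I_m.+3) : 'I_m.+3 * 'I_m.+3 :=
  if k == 0 :> nat then (inord m, inord m.+2)
  else if k == m.+1 :> nat then (inord m.-1, inord m.+1)
  else (inord k.-1, inord k).
have fi : injective f.
  move=> k l eq_kl; apply: val_inj => /=.
  have [ltk ltl] := (ltn_ord k, ltn_ord l).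
  have := congr1 (fun p => val p.1) eq_kl.
  have := congr1 (fun p => val p.2) eq_kl.
  rewrite /f; case: eqP => ?; case: eqP => ?; repeat case: eqP => ?;
    rewrite /= !inordK; lia.
transitivity #|[set k : 'I_m.+3 | (0 < m)%N || (k != 1%N :> nat)]|.
  rewrite -(card_imset _ fi); apply: eq_card => -[i k].
  rewrite !inE /= comp_patTE /patT; have [lti ltk] := (ltn_ord i, ltn_ord k).
  apply/idP/imsetP => [ik|[l + e]].
    pose l : 'I_m.+3 := if (i == m :> nat) && (k == m.+2 :> nat) then ord0 else k.
    exists l; first by rewrite inE /l; case: ifP => //= ; lia.
    rewrite /l; case: ifP => [/andP[/eqP im /eqP km]|ikm].
      by rewrite /f /=; congr (_, _); apply: val_inj; rewrite /= inordK; lia.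
    rewrite /f; case: eqP => k0; first by lia.
    by case: eqP => km; congr (_, _); apply: val_inj; rewrite /= inordK; lia.
  rewrite inE => m_l; have ltl := ltn_ord l.
  have := congr1 (fun p => val p.1) e; have := congr1 (fun p => val p.2) e.
  by rewrite /f; case: eqP => l0; last case: eqP => lm; rewrite /= !inordK; lia.
have [m0|m_gt0] := posnP m.
  have -> : [set k : 'I_m.+3 | (0 < 0)%N || (k != 1%N :> nat)] = [set~ inord 1].
    by apply/setP=> k; rewrite !inE -val_eqE /= inordK.
  by rewrite cardsC1 card_ord m0.
have -> : [set k : 'I_m.+3 | true || (k != 1%N :> nat)] = setT.
  by apply/setP=> k; rewrite !inE.
by rewrite cardsT card_ord.
Qed.

(** This describes how [R r] moves the characters of [V]: commutation carries an entry of the last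
    column from row [l] up to row [r]. *)
Lemma commg_root_R (r l : 'I_m.+3) (x : {'GL_m.+3[F]}) d :
    (r < l)%N -> (l < m.+2)%N -> x \in R r ->
  [~ root_elt l ord_max d, x] = root_elt r ord_max (- (ent x r l * d)).
Proof.
move=> ltrl ltl /patP xR; have ltr := ltn_trans ltrl ltl.
have r_l : (r == l) = false by rewrite -val_eqE ltn_eqF.
have mul_delta (a z : 'I_m.+3) : ent x *m delta_mx a z
    = \matrix_(b, k) (ent x b a * (k == z)%:R).
  apply/matrixP => b k; rewrite !mxE (bigD1 a) //= mxE eqxx big1 ?addr0 // => e.
  by move=> ea; rewrite mxE (negPf ea) mulr0.
pose z := ord_max : 'I_m.+3.
have x_l : ent x *m delta_mx l z = delta_mx l z + ent x r l *: delta_mx r z.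
  rewrite mul_delta; apply/matrixP => b k; rewrite !mxE.
  have [->|br] := eqVneq b r; first by rewrite r_l add0r.
  by rewrite xR ?mulr0 ?addr0 -?natrM ?mulnb // /patR (negPf br).
have x_r : ent x *m delta_mx r z = delta_mx r z.
  rewrite mul_delta; apply/matrixP => b k; rewrite !mxE xR -?natrM ?mulnb //.
  by rewrite /patR; apply/negP => /and3P[/eqP->]; rewrite ltnn.
have l_x : delta_mx l z *m ent x = delta_mx l z.
  apply/matrixP => b k; rewrite !mxE (bigD1 z) //= !mxE eqxx andbT.
  rewrite big1 => [|e ne]; last by rewrite mxE (negPf ne) andbF mul0r.
  rewrite addr0 xR -?natrM ?mulnb 1?[k == _]eq_sym //.
  by rewrite /patR -val_eqE /= gtn_eqF.
apply: (mulgI (x * root_elt l ord_max d)%g).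
rewrite -/z; transitivity (root_elt l z d * x)%g.
  by rewrite commgEl conjgE -!mulgA mulKVg mulKVg.
apply: ent_inj; rewrite !entM !root_eltE //.
have dlr : delta_mx l z *m delta_mx r z = 0 :> 'M[F]_m.+3.
  by rewrite mul_delta_mx_cond -val_eqE /= gtn_eqF.
have drr : delta_mx r z *m delta_mx r z = 0 :> 'M[F]_m.+3.
  by rewrite mul_delta_mx_cond -val_eqE /= gtn_eqF.
rewrite !(mulmxDl, mulmxDr, mul1mx, mulmx1) -!scalemxAl -!scalemxAr l_x x_l.
rewrite -?scalemxAr x_r.
rewrite -scalemxAl.
rewrite mulmxDl -scalemxAl dlr drr.
rewrite !scaler0 !addr0 !scalerDr !scalerA !scaleNr [ent x r l * d]mulrC.
by rewrite !scaler0 ?oppr0 !addr0 addrA addrK.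
Qed.

(** Column [m+1] is free in row [r], and so is column [m] when [r < m]; later only the gain of a
    second factor [q] matters. *)
Lemma card_R (r : 'I_m.+3) :
  (r <= m)%N -> (q ^ (if r < m then 2 else 1) <= #|R r|)%N.
Proof.
move=> lerm; have ltrm2 : (r < m.+3)%N by [].
rewrite card_pat; last by case: (patR_pattern r).
rewrite leq_exp2l ?(finField_card_gt1 F) //.
have r1 : (r, inord m.+1) \in [set p | patR r p.1 p.2].
  by rewrite inE /patR eqxx /= inordK; lia.
case: ifP => ltrm; last by apply/card_gt0P; exists (r, inord m.+1).
have r0 : (r, inord m) \in [set p | patR r p.1 p.2].
  by rewrite inE /patR eqxx /= inordK; lia.
have -> : (2 = #|[set (r, inord m.+1 : 'I_m.+3); (r, inord m)]|)%N.
  by rewrite cards2 xpair_eqE eqxx -val_eqE /= !inordK //; lia.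
by apply/subset_leq_card/subsetP => p /set2P[]->.
Qed.

Lemma TI_R_inertia (l : Iirr V) (r : 'I_m.+3) (c : F) :
    root_elt r ord_max c \notin cfker 'chi_l -> (r <= m)%N ->
  R r :&: 'I_G['chi_l] = 1%g.
Proof.
move=> nker lerm; have lin_l := char_abelianP _ abelian_V l.
apply/trivgP/subsetP=> x /setIP[Rx /setIP[Gx Ix]]; rewrite inE.
have nVx : x \in 'N(V) := subsetP (normal_norm normal_V) x Gx.
have kerx := inertia_linP lin_l nVx Ix.
apply/eqP/ent_inj/matrixP => i j; rewrite ent1 mxE.
have /patP xR := Rx.
have [|/xR//] := boolP (patR r i j); case/and3P=> /eqP-> ltrj ltj.
have -> : (r == j) = false by rewrite -val_eqE ltn_eqF.
apply: contraNeq nker => xrj0.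
(* The scalar is chosen so that the commutator with [x] is exactly [root_elt r ord_max c], which
   invariance would put in the kernel. *)
have := kerx (root_elt j ord_max (- (c / ent x r j))).
rewrite (commg_root_R _ ltrj ltj Rx) mulrN opprK.
rewrite [ent x r j * _]mulrC divfK //; apply.
by apply: root_elt_pat; rewrite // /patV ltj /=.
Qed.

(** As [R r] meets the inertia group trivially, the product of their orders is at most [#|G|]. *)
Lemma inertia_bound (l : Iirr V) (r : 'I_m.+3) (c : F) :
    root_elt r ord_max c \notin cfker 'chi_l -> (r <= m)%N ->
  (q ^ (if r < m then 2 else 1) * #|'I_G['chi_l]| <= q * #|T|)%N.
Proof.
move=> nker lerm; rewrite -card_G_T.
apply: leq_trans (leq_mul (card_R lerm) (leqnn _)) _.
rewrite -TI_cardMg ?(TI_R_inertia nker) //.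
apply/subset_leq_card; rewrite mul_subG ?subsetIl //.
by apply: pat_sub => i j /and3P[].
Qed.

Lemma small_inertia (l : Iirr V) :
  ~~ (W \subset cfker 'chi_l) -> (#|'I_G['chi_l]| <= #|T|)%N.
Proof.
move=> nW; have q_gt0 : (0 < q)%N := ltnW (finField_card_gt1 F).
have [/existsP[r /existsP[c /andP[lerm nker]]]|none] :=
  boolP [exists r : 'I_m.+3, exists c : F, (r <= m)%N &&
           (root_elt r ord_max c \notin cfker 'chi_l)].
  rewrite -(leq_pmul2l q_gt0); apply: leq_trans (inertia_bound nker lerm).
  rewrite leq_mul2r -{1}[q]expn1 leq_exp2l ?(finField_card_gt1 F) //.
  by case: ifP; rewrite orbT.
case/negP: nW; apply: pat_gen => [|i j c]; first by case: patW_pattern.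
case/andP=> leim /eqP jm; have -> : j = ord_max by apply: val_inj.
apply: contraNT none => nker; apply/existsP; exists i; apply/existsP; exists c.
by rewrite leim.
Qed.

Lemma large_inertia (l : Iirr V) :
  ~~ (W \subset cfker 'chi_l) -> (#|T| <= #|'I_G['chi_l]|)%N ->
  T \subset 'I_G['chi_l].
Proof.
move=> nW leTI; have lin_l := char_abelianP _ abelian_V l.
have q_gt1 := (finField_card_gt1 F); have q_gt0 : (0 < q)%N := ltnW q_gt1.
have sW0 : W0 \subset cfker 'chi_l.
  apply: pat_gen => [|i j c]; first by case: patW0_pattern.
  case/andP=> ltim /eqP jm; have -> : j = ord_max by apply: val_inj.
  (* Above row [m] the bound has a factor [q ^ 2], which makes the inertia group strictly smaller
     than [T]. *)
  apply: contraLR leTI => nker; rewrite -ltnNge -(ltn_pmul2l q_gt0).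
  have := inertia_bound nker (ltnW ltim); rewrite ltim.
  have := cardG_gt0 'I_G['chi_l]; move: #|_| #|T| => a b a0; nia.
have sTG := normal_sub normal_T.
apply/subsetP=> t Tt; have Gt := subsetP sTG t Tt; rewrite inE Gt /=.
have nVt : t \in 'N(V) := subsetP (normal_norm normal_V) t Gt.
apply/(inertia_linP lin_l nVt) => v Vv.
by apply: (subsetP sW0); apply: (subsetP commg_VT); apply: mem_commg.
Qed.

(** By the Clifford count, [q] times this number is the difference of the indices in [T] of its
    derived subgroup and of the join of that subgroup with [W]. *)
Lemma card_deg_q_nontrivial :
  #|[set i : Iirr G | ('chi_i 1%g == q%:R) && ~~ (W \subset cfker 'chi_i)]|
   = (q ^ (if (0 < m)%N then m.+1 else 0) * (q - 1))%N.
Proof.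
have q_gt1 := (finField_card_gt1 F); have q_gt0 : (0 < q)%N := ltnW q_gt1.
have nTG := normal_T; have nWG := normal_W; have nVG := normal_V.
have sWT : W \subset T := subset_trans sub_WV sub_VT.
have iT : #|G : T| = q.
  apply/eqP; rewrite -(eqn_pmul2l (cardG_gt0 T)) Lagrange ?normal_sub //.
  by rewrite card_G_T mulnC.
have inerT := inertia_lin_char nTG nVG sub_VT (@small_inertia).
have indT := induced_from_lin_char nTG nWG nVG (@small_inertia) (@large_inertia).
have := card_lin_chars_induced nTG nWG inerT indT.
rewrite card_lin_chars_nontrivial ?(normalS sWT (normal_sub nTG)) // iT.
set N1 := #|_|; move=> eN1; apply/eqP; rewrite -(eqn_pmul2l q_gt0) -eN1.
set e := (if (0 < m)%N then m.+1 else 0).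
have D_gt0 : (0 < #|T^`(1)%g|)%N := cardG_gt0 _.
have i1 : #|T : T^`(1)%g| = (q ^ e.+2)%N.
  apply/eqP; rewrite -(eqn_pmul2l D_gt0) (Lagrange (der_sub 1 T)).
  by rewrite card_T_der mulnC /e; case: ifP.
have i2 : #|T : T^`(1)%g <*> W| = (q ^ e.+1)%N.
  have sDWT : T^`(1) <*> W \subset T by rewrite join_subG der_sub.
  apply/eqP; rewrite -(eqn_pmul2l (cardG_gt0 [group of T^`(1)%g <*> W])).
  rewrite (Lagrange sDWT) card_T_der [X in _ == (X * _)%N]card_der_T_W.
  by rewrite mulnAC -expnS /e; case: ifP.
by rewrite i1 i2 !expnS !mulnBr muln1 [(q ^ e * q)%N]mulnC.
Qed.

End UnitriangularSubgroups.

(** * The quotient by [W] as a direct product *)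

Section Quotient.

Variables (m : nat) (F : finFieldType).

Local Notation G := (pat_group F (ord_lt_pattern m.+2)).
Local Notation V := (pat_group F (patV_pattern m)).
Local Notation W := (pat_group F (patW_pattern m)).
Local Notation G1 := (pat_group F (patG1_pattern m)).
Local Notation q := #|F|.

Let w := widen_ord (leqnSn m.+2).

(** On [G1] the kernel of this map is [W]; on all of [G] it would be [V]. *)
Definition corner (u : {'GL_m.+3[F]}) : {'GL_m.+2[F]} :=
  mkGL (\matrix_(i < m.+2, j < m.+2) ent u (w i) (w j)).

Let sG1G : G1 \subset G.
Proof. by apply: pat_sub => i j /andP[]. Qed.

Let w_eq i j : (w i == w j) = (i == j).
Proof. by rewrite -!val_eqE. Qed.

Lemma cornerE u : u \in G -> ent (corner u) = \matrix_(i, j) ent u (w i) (w j).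
Proof.
move=> /patP uG; apply/mkGLE/upper_unitriangularP; split=> [i j ltji|i].
  rewrite mxE uG ?w_eq -?val_eqE ?(gtn_eqF ltji) // /ord_lt /=.
  by rewrite -leqNgt ltnW.
by rewrite mxE uG ?eqxx // /ord_lt ltnn.
Qed.

Lemma cornerM : {in G1 &, {morph corner : u v / (u * v)%g}}.
Proof.
move=> u v /(subsetP sG1G) Gu /(subsetP sG1G) Gv.
have Guv : (u * v)%g \in G by rewrite groupM.
apply: ent_inj; rewrite entM !cornerE // entM; apply/matrixP => i j; rewrite !mxE.
rewrite big_ord_recr /= [X in _ + X](_ : _ = 0) ?addr0.
  by apply: eq_bigr => k _; rewrite !mxE.
(* The extra summand involves the last row of [v], which vanishes left of the diagonal. *)
have /patP-> := Gv; first by rewrite -val_eqE /= gtn_eqF ?mulr0.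
by rewrite /ord_lt /= -leqNgt ltnW.
Qed.

Canonical corner_morphism := Morphism cornerM.

Lemma ker_corner : 'ker corner = W.
Proof.
apply/setP=> u; apply/idP/idP => [/morphpreP[G1u]|Wu].
  move/set1P=> u1; have Gu := subsetP sG1G _ G1u; apply/patP => i j nW.
  have /patP u0 := G1u; have [/u0//|] := boolP (~~ patG1 i j).
  rewrite negbK => G1ij.
  have [ltim ltjm] : (i < m.+2)%N /\ (j < m.+2)%N.
    by move: nW G1ij; rewrite /patW /patG1; have := ltn_ord j; lia.
  have := cornerE Gu; rewrite u1 ent1.
  move=> /matrixP/(_ (Ordinal ltim) (Ordinal ltjm)).
  rewrite !mxE -w_eq.
  have -> : w (Ordinal ltim) = i by apply: val_inj.
  by have -> : w (Ordinal ltjm) = j by apply: val_inj.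
have G1u : u \in G1 := subsetP (sub_WG1 m F) _ Wu.
apply/morphpreP; split=> //; apply/set1P/ent_inj.
rewrite cornerE ?(subsetP sG1G) // ent1; apply/matrixP => i j; rewrite !mxE.
have /patP-> := Wu; first by rewrite w_eq.
by rewrite /patW /= negb_and orbC ltn_eqF.
Qed.

Lemma im_corner : corner @* G1 = U m.+2 F.
Proof.
rewrite -pat_ord_lt; apply/setP=> v; apply/morphimP/idP => [[u _ G1u ->]|].
  have Gu := subsetP sG1G _ G1u; apply/patP => i j nlt.
  by rewrite cornerE // mxE; have /patP-> := Gu; rewrite ?w_eq.
move=> Uv; have /patP v0 := Uv.
(* A preimage of [v] is obtained by bordering it with the last row and column of the identity. *)
pose M := \matrix_(i < m.+3, j < m.+3)
  if (i < m.+2)%N && (j < m.+2)%N then ent v (inord i) (inord j) else (i == j)%:R.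
have triM : upper_unitriangular M.
  apply/upper_unitriangularP; split=> [i j ltji|i]; rewrite mxE.
    have ij : (i == j) = false by rewrite -val_eqE gtn_eqF.
    case: ifP => [/andP[lti ltj]|_]; last by rewrite ij.
    by rewrite v0 /ord_lt -?val_eqE /= !inordK // ?gtn_eqF // -leqNgt ltnW.
  by case: ifP => _; rewrite ?eqxx // v0 ?eqxx // /ord_lt ltnn.
have G1M : mkGL M \in G1.
  apply/patP => i j nG1; rewrite mkGLE // mxE; case: ifP => // /andP[lti ltj].
  rewrite v0 -?val_eqE /ord_lt /= ?inordK //.
  by move: nG1; rewrite /patG1; lia.
exists (mkGL M) => //; apply: ent_inj; rewrite cornerE ?(subsetP sG1G) //.
apply/matrixP => i j; rewrite mxE mkGLE // mxE /= !ltn_ord /=.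
by congr (ent v _ _); apply: val_inj; rewrite /= inordK.
Qed.

Lemma N_G1_quotient k : N k (G1 / W)%G = N k (U m.+2 F).
Proof.
apply: N_isog; rewrite -ker_corner -im_corner; exact: first_isog.
Qed.

Lemma dprod_quotient : ((V / W) \x (G1 / W) = G / W)%g.
Proof.
have sVG : V \subset G := normal_sub (normal_V m F).
have nWG : G \subset 'N(W) := normal_norm (normal_W m F).
have nWV := subset_trans sVG nWG; have nWG1 := subset_trans sG1G nWG.
have VG1 : V :&: G1 = W.
  apply/setP=> u; rewrite in_setI; apply/andP/idP => [[/patP Vu /patP G1u]|Wu].
    apply/patP => i j nW; have [/Vu//|] := boolP (~~ patV i j).
    rewrite negbK => Vij; apply: G1u.
    by move: nW Vij; rewrite /patW /patG1 /patV; have := ltn_ord j; lia.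
  by rewrite (subsetP (sub_WV m F)) // (subsetP (sub_WG1 m F)).
(* By orders: [V] and [G1] meet in [W], while [V] has order [q * #|W|] and [G] has order
   [q * #|G1|]. *)
have VmG1 : (V * G1)%g = G.
  apply/eqP; rewrite eqEcard mul_subG //=.
  have := mul_cardG V G1; rewrite VG1 => e.
  by rewrite -(leq_pmul2r (cardG_gt0 W)) -e card_V_W card_G_G1 mulnAC.
rewrite dprodE; first by rewrite -quotientMl // VmG1.
  apply: quotient_cents2r; rewrite commGC.
  exact: subset_trans (commgS _ sG1G) (commg_VG m F).
by rewrite -quotientGI ?sub_WV // VG1 trivg_quotient.
Qed.

Lemma N_G_quotient k : N k (G / W)%G = (q * N k (U m.+2 F))%N.
Proof.
rewrite (N_dprod_abelian _ dprod_quotient) ?quotient_abelian ?abelian_V //.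
rewrite N_G1_quotient card_quotient; last first.
  exact: subset_trans (normal_sub (normal_V m F)) (normal_norm (normal_W m F)).
congr (_ * _)%N; apply/eqP; rewrite -(eqn_pmul2l (cardG_gt0 W)).
by rewrite Lagrange ?sub_WV // card_V_W mulnC.
Qed.

(** The characters of degree [q] are split according to whether their kernel contains [W]. *)
Lemma N_unitriangular_rec :
  N q (U m.+3 F) =
    (q * N q (U m.+2 F) + q ^ (if (0 < m)%N then m.+1 else 0) * (q - 1))%N.
Proof.
rewrite -N_G_quotient -card_deg_q_nontrivial N_quotient ?normal_W //.
have <- : G = U m.+3 F by apply/val_inj; rewrite /= pat_ord_lt.
rewrite /N -(cardsID [set i | W \subset cfker 'chi[G]_i]
                     [set i : Iirr G | 'chi_i 1%g == q%:R]).
by congr (_ + _)%N; apply: eq_card => i; rewrite !inE andbC.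
Qed.

End Quotient.

(** * Closed form and polynomiality *)

Lemma N_U2 (F : finFieldType) : N #|F| (U 2 F) = 0%N.
Proof.
apply/eqP; rewrite cards_eq0; apply/eqP/setP=> i; rewrite !inE.
have abU : abelian (U 2 F).
  have <- : pat_group F (ord_lt_pattern 1) = U 2 F.
    by apply/val_inj; rewrite /= pat_ord_lt.
  apply: pat_abelian => a k; apply/rel_compP => -[j].
  by rewrite /ord_lt; have := ltn_ord k; lia.
rewrite lin_char1 ?(char_abelianP _ abU i) // eq_sym pnatr_eq1.
by rewrite gtn_eqF ?finField_card_gt1.
Qed.

Lemma N_unitriangular m (F : finFieldType) :
  N #|F| (U m.+3 F) = (#|F| ^ m * (#|F| - 1) * (m * #|F| + 1))%N.
Proof.
elim: m => [|m IHm]; rewrite N_unitriangular_rec.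
  by rewrite N_U2 muln0 add0n /= !expn0 mul0n add0n muln1.
rewrite IHm /= !expnS; move: #|F| (#|F| ^ m)%N => q t.
(* Abstracting the truncated difference leaves a polynomial identity. *)
by move: (q - 1)%N => d; nia.
Qed.

Theorem mainTheorem1 :
  (forall (q : nat) (F : finFieldType), prime_power q -> #|F| = q ->
     [/\ N q (U 3 F) = (q - 1)%N,
         N q (U 4 F) = (q * (q - 1) * (q + 1))%N
       & forall n : nat, (5 <= n)%N ->
           N q (U n F) = (q * N q (U (n - 1) F) + q ^ (n - 2) * (q - 1))%N])
  /\
  (forall n : nat, (3 <= n)%N ->
     exists P : {poly int},
       forall (q : nat) (F : finFieldType), prime_power q -> #|F| = q ->
         Posz (N q (U n F)) = (P.[Posz q])%R).
Proof.
split=> [q F _ <-|[|[|[|m]]] // _]; last first.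
  (* This is the closed form of [N_unitriangular], with [n = m + 3]. *)
  exists ('X^m * ('X - 1) * ((Posz m)%:P * 'X + 1)) => q F _ <-.
  rewrite N_unitriangular !hornerE !PoszM PoszD PoszM.
  rewrite -subzn ?(ltnW (finField_card_gt1 F)) //.
  congr (_ * _ * _); exact: rmorphXn.
split; [by rewrite N_unitriangular; lia | by rewrite N_unitriangular; lia |].
(* Here [n = m + 4], so the recurrence is taken at [m + 1] and its exponent is [m + 2 = n - 2]. *)
by case=> [|[|[|[|m]]]] // _; rewrite !subSS !subn0 N_unitriangular_rec.
Qed.
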